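(* For every prime $p$ and all integers $e_1\ge e_2\ge 1$, $$R(p^{e_1},p^{e_2})=\begin{cases}0, & e_1>e_2\ge 1,\\ p^{2e-1}(p-1), & e_1=e_2=e>1,\\ p^2-p-1, & e_1=e_2=1.\end{cases}$$
   Context: For $n\in\mathbb{N}$ and $k\in\mathbb{Z}$, $c_n(k)=\sum_{1\le j\le n,\ \gcd(j,n)=1}\exp(2\pi i jk/n)$ is the Ramanujan sum. For $m_1,m_2\in\mathbb{N}$ with $m=\operatorname{lcm}(m_1,m_2)$, $R(m_1,m_2)=\sum_{1\le k\le m,\ \gcd(k,m)=1}c_{m_1}(k-1)c_{m_2}(k-1)$. *)

(* Defs.v *)
From mathcomp Require Export all_boot all_order all_algebra.
From mathcomp Require Export complex.
From mathcomp Require Export reals sequences exp trigo.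

Set Implicit Arguments.
Unset Strict Implicit.
Unset Printing Implicit Defensive.

Import GRing.Theory Num.Theory.
Local Open Scope ring_scope.
Local Open Scope complex_scope.

Definition cexp (R : realType) (z : R[i]) : R[i] :=
  (expR (complex.Re z))%:C * (cos (complex.Im z) +i* sin (complex.Im z)).

Definition ramanujan_sum (R : realType) (n : nat) (k : int) : R[i] :=
  \sum_(1 <= j < n.+1 | coprime j n)
    cexp (2 * (pi : R)%:C * 'i%C * (j%:Z * k)%:~R / n%:R).

(* [k%:Z - 1] is a subtraction in [int]. *)
Definition ramanujan_R (R : realType) (m1 m2 : nat) : R[i] :=
  let m := lcmn m1 m2 in
  \sum_(1 <= k < m.+1 | coprime k m)
    ramanujan_sum R m1 (k%:Z - 1) * ramanujan_sum R m2 (k%:Z - 1).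

Arguments ramanujan_sum R n k : clear implicits.
Arguments ramanujan_R R m1 m2 : clear implicits.

(* Main.v *)
Require Import Defs.
From mathcomp Require Import ring lra.
Import Order.TTheory GRing.Theory Num.Theory.
Local Open Scope ring_scope.
Local Open Scope complex_scope.

(* A full geometric sum modulo [n] is [n] or [0], so the Ramanujan sum modulo
   [p ^ f.+1] at [t] is [p ^ f.+1 * [p ^ f.+1 | t] - p ^ f * [p ^ f | t]].
   Hence, writing [t = k - 1], only the [p] multiples [t < p ^ f.+1] of [p ^ f]
   contribute to the outer sum; for [f > 0] all of them come from a [k] coprime to [p],
   while for [f = 0] the residue [t = p - 1] is excluded. *)

Definition unity_rootC (R : realType) (n : nat) : R[i] :=
  cos (2 * pi / n%:R) +i* sin (2 * pi / n%:R).

Lemma expr_cos_sin (R : realType) (x : R) (a : nat) :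
  (cos x +i* sin x) ^+ a = cos (x * a%:R) +i* sin (x * a%:R).
Proof.
elim: a => [|a IHa]; first by rewrite mulr0 cos0 sin0.
rewrite exprSr IHa -natr1 mulrDr mulr1 cosD sinD.
by apply/eqP; rewrite eq_complex /=; apply/andP; split; apply/eqP; ring.
Qed.

(** The exponent is purely imaginary, so the [expR] factor is 1. A natural [a] suffices because
    [k - 1] is never negative in the outer sum. *)
Lemma cexp_unity_rootC (R : realType) (n a : nat) :
  cexp (2 * (pi : R)%:C * 'i%C * (a%:Z)%:~R / n%:R) = unity_rootC R n ^+ a.
Proof.
have -> : 2 * (pi : R)%:C * 'i%C * (a%:Z)%:~R / n%:R
    = 0 +i* (2 * pi / n%:R * a%:R) :> R[i].
  have -> : (a%:Z)%:~R = (a%:R : R)%:C :> R[i] by rewrite -pmulrn rmorph_nat.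
  have -> : (n%:R : R[i])^-1 = ((n%:R : R)^-1)%:C by rewrite fmorphV rmorph_nat.
  have -> : (2 : R[i]) = (2 : R)%:C by rewrite rmorph_nat.
  by apply/eqP; rewrite eq_complex /=; apply/andP; split; apply/eqP; ring.
by rewrite /cexp /= expR0 mul1r expr_cos_sin.
Qed.

Lemma unity_rootC_expn (R : realType) (n : nat) :
  (0 < n)%N -> unity_rootC R n ^+ n = 1.
Proof.
move=> n0; rewrite expr_cos_sin mulfVK ?pnatr_eq0 -?lt0n //.
by rewrite mulr_natl cos2pi sin2pi.
Qed.

(** The real part is already below 1: it is [cos (2y) = 1 - 2 sin(y)^2] with [y = pi * r / n]
    strictly between 0 and [pi]. *)
Lemma unity_rootC_exp_neq1 (R : realType) (n r : nat) :
  (0 < r < n)%N -> unity_rootC R n ^+ r != 1.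
Proof.
move=> /andP[r0 rn]; rewrite expr_cos_sin eq_complex negb_and /=.
have n_gt0 : (0 < n)%N := leq_ltn_trans (leq0n r) rn.
have n0 : 0 < n%:R :> R by rewrite ltr0n.
set y : R := pi * (r%:R / n%:R).
have -> : 2 * pi / n%:R * r%:R = y *+ 2 :> R.
  by rewrite /y; field; rewrite gt_eqF.
have sy : 0 < sin y.
  apply: sin_gt0_pi; rewrite mulr_gt0 ?pi_gt0 ?divr_gt0 ?ltr0n //=.
  by rewrite gtr_pMr ?pi_gt0 // ltr_pdivrMr // mul1r ltr_nat.
rewrite cos_mulr2n cos2sin2; apply/orP; left; rewrite lt_eqF //.
have := exprn_gt0 2 sy; lra.
Qed.

Lemma unity_rootC_exp_eq1 (R : realType) (n k : nat) :
  (0 < n)%N -> (unity_rootC R n ^+ k == 1) = (n %| k)%N.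
Proof.
move=> n0; rewrite -(expr_mod k (unity_rootC_expn R n n0)) /dvdn.
have [->|rN0] := eqVneq (k %% n)%N 0%N; first by rewrite expr0 eqxx.
by apply/negbTE/unity_rootC_exp_neq1; rewrite lt0n rN0 ltn_mod.
Qed.

Lemma sum_unity_rootC_exp (R : realType) (n k : nat) : (0 < n)%N ->
  \sum_(0 <= j < n) unity_rootC R n ^+ (j * k) = n%:R *+ (n %| k)%N.
Proof.
move=> n0; under eq_bigr do rewrite mulnC exprM.
rewrite -(unity_rootC_exp_eq1 R) //; have [->|wN1] := eqVneq.
  by under eq_bigr do rewrite expr1n; rewrite big_const_nat iter_addr subn0 addr0.
(* With [w] the [k]-th power of the root, multiplying the sum by the nonzero [w - 1] gives
   [w ^+ n - 1 = 0]. *)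
apply/eqP; rewrite -(mulrI_eq0 _ (lregP (_ : unity_rootC R n ^+ k - 1 != 0))).
  by rewrite big_mkord -subrX1 exprAC unity_rootC_expn // expr1n subrr.
by rewrite subr_eq0.
Qed.

(** In each block of [d] consecutive indices starting at a multiple of [d], only the first index
    passes the filter. *)
Lemma sum_multiples (V : nmodType) (d m : nat) (h : nat -> V) : (0 < d)%N ->
  \sum_(0 <= t < d * m | (d %| t)%N) h t = \sum_(0 <= s < m) h (d * s)%N.
Proof.
move=> d0; elim: m => [|m IHm]; first by rewrite muln0 !big_nil.
rewrite big_nat_recr //= -IHm mulnS addnC.
rewrite (@big_cat_nat _ _ _ (d * m)%N) ?leq_addr //=; congr (_ + _).
rewrite big_ltn_cond; last by rewrite -[ltnLHS]addn0 ltn_add2l.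
rewrite dvdn_mulr // big_nat_cond big1 ?addr0 // => t /andP[/andP[lo hi]].
rewrite -(subnKC (ltnW lo)) dvdn_addr ?dvdn_mulr //.
by rewrite gtnNdvd ?subn_gt0 // ltn_subLR ?(ltnW lo).
Qed.

(* Dropping the multiples of [p] from the full geometric sum modulo [p ^ f.+1]
   leaves the difference of the full sums modulo [p ^ f.+1] and [p ^ f]. *)
Lemma ramanujan_sum_primepow (R : realType) (p f k : nat) : prime p ->
  ramanujan_sum R (p ^ f.+1) k%:Z =
    (p ^ f.+1)%:R *+ (p ^ f.+1 %| k)%N - (p ^ f)%:R *+ (p ^ f %| k)%N.
Proof.
move=> pp; have p0 := prime_gt0 pp.
have n0 g : (0 < p ^ g)%N by rewrite expn_gt0 p0.
have cop j : coprime j (p ^ f.+1) = ~~ (p %| j)%N.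
  by rewrite coprime_sym coprime_pexpl // prime_coprime.
rewrite /ramanujan_sum.
under eq_bigr do rewrite -PoszM cexp_unity_rootC.
rewrite -!sum_unity_rootC_exp //.
have -> : \sum_(0 <= s < p ^ f) unity_rootC R (p ^ f) ^+ (s * k)
    = \sum_(0 <= j < p ^ f.+1 | (p %| j)%N) unity_rootC R (p ^ f.+1) ^+ (j * k).
  rewrite expnS sum_multiples //; apply: eq_bigr => s _.
  rewrite -mulnA -!cexp_unity_rootC (PoszM p) intrM natrM -(pmulrn 1 p).
  by congr cexp; field; rewrite !pnatr_eq0 -!lt0n p0 n0.
rewrite [X in _ = X - _](bigID (fun j => p %| j)%N) /=.
rewrite addrAC subrr add0r.
under eq_bigl do rewrite cop.
(* One range starts at 1, the other at 0; the end terms [0] and [p ^ f.+1] are multiples of [p], so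
   both are filtered out. *)
rewrite [RHS]big_ltn_cond // dvdn0 /= big_mkcond big_nat_recr //= dvdn_exp //=.
by rewrite addr0 -big_mkcond.
Qed.

(** Only the factor with the larger exponent is expanded; [g] stays abstract to cover every smaller
    or equal exponent in the other factor. *)
Lemma sum_ramanujan_primepow (R : realType) (p f : nat) (g : int -> R[i]) :
  prime p ->
  \sum_(1 <= k < (p ^ f.+1).+1 | coprime k (p ^ f.+1))
     ramanujan_sum R (p ^ f.+1) (k%:Z - 1) * g (k%:Z - 1) =
  (p ^ f.+1)%:R * g 0
    - (p ^ f)%:R *
      \sum_(0 <= s < p | ~~ (p %| (p ^ f * s).+1)%N) g (p ^ f * s)%N%:Z.
Proof.
move=> pp; have p0 := prime_gt0 pp.
have n0 : (0 < p ^ f)%N by rewrite expn_gt0 p0.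
have N0 : (0 < p ^ f.+1)%N by rewrite expn_gt0 p0.
have cop j : coprime j (p ^ f.+1) = ~~ (p %| j)%N.
  by rewrite coprime_sym coprime_pexpl // prime_coprime.
rewrite big_add1 /=.
under eq_bigr => t _ do rewrite -predn_int //= ramanujan_sum_primepow // mulrBl.
under eq_bigl do rewrite cop.
rewrite sumrB; congr (_ - _).
  rewrite big_ltn_cond // gtnNdvd ?prime_gt1 //= dvdn0 mulr1n.
  rewrite big_nat_cond big1 ?addr0 // => t /andP[/andP[lo hi] _].
  by rewrite gtnNdvd // mul0r.
(* Coprimality moves into the summand, leaving divisibility by [p ^ f] as the only filter for
   [sum_multiples]. *)
rewrite mulr_sumr big_mkcond [RHS]big_mkcond expnSr /=.
rewrite -(@sum_multiples _ (p ^ f) p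
  (fun t => if ~~ (p %| t.+1)%N then (p ^ f)%:R * g t%:Z else 0)) //.
rewrite [RHS]big_mkcond /=; apply: eq_bigr => t _.
by case: (p ^ f %| t)%N; case: (p %| t.+1)%N => //=; rewrite mul0r.
Qed.

Theorem corollary14 (R : realType) (p e1 e2 : nat) (hp : prime p)
    (he2 : (1 <= e2)%N) (he12 : (e2 <= e1)%N) :
  ramanujan_R R (p ^ e1)%N (p ^ e2)%N =
    if (e2 < e1)%N then 0
    else if (1 < e1)%N then p%:R ^+ (2 * e1 - 1)%N * (p%:R - 1)
    else p%:R ^+ 2 - p%:R - 1.
Proof.
have p0 := prime_gt0 hp.
have n0 g : (0 < p ^ g)%N by rewrite expn_gt0 p0.
case: e1 he12 => [|f]; first by rewrite leqn0; case: e2 he2.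
case: e2 he2 => // h _ he12.
rewrite /ramanujan_R (lcmn_idPl (dvdn_exp2l p he12)).
rewrite (@sum_ramanujan_primepow R p f (ramanujan_sum R (p ^ h.+1))) //.
under eq_bigr do rewrite ramanujan_sum_primepow //.
rewrite ramanujan_sum_primepow // !dvdn0 !mulr1n.
have unrestricted F : (0 < f)%N ->
    \sum_(0 <= s < p | ~~ (p %| (p ^ f * s).+1)%N) F s
    = \sum_(0 <= s < p) F s :> R[i].
  move=> f0; apply: eq_bigl => s; apply/negP.
  rewrite -addn1 dvdn_addr ?dvdn1; first by move/eqP=> p1; rewrite p1 in hp.
  by rewrite dvdn_mulr // dvdn_exp.
move: he12; rewrite ltnS leq_eqVlt => /orP[/eqP ->|lt_hf]; last first.
  (* Since [p ^ h.+1] divides [p ^ f], all [p] terms equal the value at 0, and [p ^ f * p] cancels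
     [p ^ f.+1]. *)
  rewrite ltnS lt_hf unrestricted ?(leq_ltn_trans _ lt_hf) //.
  under eq_bigr => s _.
    rewrite !dvdn_mulr ?dvdn_exp2l ?(ltnW lt_hf) // !mulr1n; over.
  rewrite big_const_nat iter_addr addr0 subn0 expnS natrM -mulr_natl.
  by ring.
rewrite ltnn ltnS.
have dvd_pf s : (s < p)%N -> (p ^ f.+1 %| p ^ f * s)%N = (s == 0)%N.
  move=> sp; rewrite expnSr dvdn_pmul2l //.
  by case: s sp => [|s] sp; rewrite ?dvdn0 // gtnNdvd.
rewrite big_nat_cond.
under eq_bigr => s /andP[/andP[_ sp] _] do rewrite dvd_pf // dvdn_mulr // mulr1n.
rewrite -big_nat_cond.
case: (posnP f) => [->|f0].
  under eq_bigl do rewrite expn0 mul1n.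
  (* Excluding [s = p - 1] leaves [p - 1] terms, with total [p - (p - 1) = 1]. *)
  have -> : \sum_(0 <= s < p | ~~ (p %| s.+1)%N)
        ((p ^ 1)%:R *+ (s == 0%N) - (p ^ 0)%:R) = 1 :> R[i].
    case: p hp p0 {n0 unrestricted dvd_pf} => // q hq _; rewrite expn1 expn0.
    rewrite big_mkcond big_nat_recr //= dvdnn addr0.
    under eq_big_nat => s /andP[_ sq] do rewrite gtnNdvd //=.
    have q0 : (0 < q)%N by have := prime_gt1 hq.
    rewrite sumrB [X in X - _](big_ltn q0) big_nat_cond big1 /=; last first.
      by move=> s /andP[/andP[s0 _] _]; rewrite gtn_eqF.
    rewrite big_const_nat iter_addr addr0 subn0 addr0 -natr1 addrAC subrr.
    by rewrite add0r.
  by rewrite expn1 expn0; ring.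
(* The gain [p ^ f.+1] at [s = 0] balances the [p] losses of [p ^ f], so only the contribution of
   [k = 1] remains. *)
have sum0 : \sum_(0 <= s < p) ((p ^ f.+1)%:R *+ (s == 0%N) - (p ^ f)%:R) = 0
    :> R[i].
  rewrite sumrB [X in X - _](big_ltn p0) big_nat_cond big1 /=; last first.
    by move=> s /andP[/andP[s0 _] _]; rewrite gtn_eqF.
  by rewrite big_const_nat iter_addr !addr0 subn0 expnSr natrM mulr_natr subrr.
rewrite unrestricted // sum0 mulr0 subr0.
have -> : (2 * f.+1 - 1 = f + f.+1)%N by rewrite mul2n -addnn addSn subn1.
by rewrite exprD exprS !expnS !natrM natrX; ring.
Qed.
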